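(* Let $\mathbb{C}$ be a univalent path category such that whenever $m : A \to B$ is a cofibration, so is $C \times m : C \times A \to C \times B$ for any object $C$. Then any cofibration $m : A \to B$ in $\mathbb{C}$ with homogeneous domain $A$ is a monomorphism.
   Context: A path category (Van den Berg–Moerdijk) is a category $\mathbb{C}$ with two classes of morphisms, fibrations and weak equivalences (a trivial fibration is a map that is both), such that: (1) fibrations are closed under composition; (2) the pullback of a fibration along any map exists and is a fibration; (3) the pullback of a trivial fibration along any map is a trivial fibration; (4) weak equivalences satisfy 2-out-of-6: for $f : A \to B$, $g : B \to C$, $h : C \to D$, if $g\circ f$ and $h \circ g$ are weak equivalences then so are $f$, $g$, $h$ and $h\circ g\circ f$; (5) every isomorphism is a trivial fibration; (6) every trivial fibration has a section; (7) $\mathbb{C}$ has a terminal object $1$ and every map $B \to 1$ is a fibration; (8) for every object $B$ the diagonal $B \to B \times B$ factors as $B \xrightarrow{r} PB \xrightarrow{p} B \times B$ with $r$ a weak equivalence and $p$ a fibration. Such a factorisation is called a path object on $B$; write $p_0 = \pi_0 \circ p$, $p_1 = \pi_1\circ p$. A homotopy from $f$ to $g$, for $f, g : X \to Y$, is a map $H : X \to PY$ with $p_0 \circ H = f$ and $p_1 \circ H = g$; write $f \sim g$ if one exists (independent of the choice of path object on $Y$). A cofibration is a map with the left lifting property against all trivial fibrations. For a fibration $u : \dot{\mathcal{U}} \to \mathcal{U}$, a fibration is $\mathcal{U}$-small if it is a pullback of $u$ along some map into $\mathcal{U}$. Choose path objects $P\mathcal{U}$ on $\mathcal{U}$ and $P\dot{\mathcal{U}}$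 on $\dot{\mathcal{U}}$ and a fibration $q : P\dot{\mathcal{U}} \to P\mathcal{U}$ commuting (via $u$ and $u \times u$) with the structure maps $r$ and $p$ of the two path objects, and such that the induced map $P\dot{\mathcal{U}} \to P\mathcal{U} \times_{\mathcal{U}\times\mathcal{U}} (\dot{\mathcal{U}}\times\dot{\mathcal{U}})$ is a fibration (such choices exist, and the following notion does not depend on them). The fibration $u$ is univalent if, for all $\mathcal{U}$-small fibrations $a : A \to C$ and $b : B \to C$ witnessed by pullback squares with top maps $i : A \to \dot{\mathcal{U}}$, $j : B \to \dot{\mathcal{U}}$ and bottom maps $f, g : C \to \mathcal{U}$ respectively, and every weak equivalence $e : A \to B$ with $b \circ e = a$, there are a homotopy $H : C \to P\mathcal{U}$ between $f$ and $g$ and a homotopy $K : A \to P\dot{\mathcal{U}}$ between $j \circ e$ and $i$ (compatibly oriented: $K$ from $j\circ e$ to $i$ and $H$ from $g$ to $f$) with $q \circ K = H \circ a$. A path category is univalent if for every fibration $f$ there is a univalent fibration $\dot{\mathcal{U}} \to \mathcal{U}$ for which $f$ is $\mathcal{U}$-small. An object $A$ is homogeneous if there is a weak equivalence $e : A \times A \times A \to A \times A \times A$ with $\langle \pi_0,\pi_1\rangle \circ e = \langle \pi_0,\pi_1\rangle$ (i.e. over $A \times A$) such that, for the sections $s_0 = \langle \pi_0,\pi_1,\pi_0\rangle$ and $s_1 = \langle \pi_0,\pi_1,\pi_1\rangle : A \times A \to A\times A\times A$, one has $\pi_2 \circ e \circ s_0 \sim \pi_2 \circ s_1$. *)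

(* Defs.v *)
Set Implicit Arguments.
Unset Strict Implicit.
Unset Printing Implicit Defensive.

Declare Scope pathcat_scope.
Delimit Scope pathcat_scope with pathcat.
Local Open Scope pathcat_scope.

Record category := Category {
  ob :> Type;
  hom : ob -> ob -> Type;
  idm : forall A, hom A A;
  comp : forall A B C, hom B C -> hom A B -> hom A C;
  comp_idl : forall A B (f : hom A B), comp (idm B) f = f;
  comp_idr : forall A B (f : hom A B), comp f (idm A) = f;
  comp_assoc : forall A B C D (h : hom C D) (g : hom B C) (f : hom A B),
    comp h (comp g f) = comp (comp h g) f
}.

Arguments hom {c} A B.
Arguments idm {c} A.
Arguments comp {c A B C} g f.

Notation "g ∘ f" := (comp g f) (at level 40, left associativity)
  : pathcat_scope.

Section CategoryNotions.
Variable C : category.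

Definition is_iso (A B : C) (f : hom A B) : Prop :=
  exists g : hom B A, g ∘ f = idm A /\ f ∘ g = idm B.

Definition mono (A B : C) (m : hom A B) : Prop :=
  forall (X : C) (f g : hom X A), m ∘ f = m ∘ g -> f = g.

(* The pullback square is
     P --p--> A
     |q       |f
     B --g--> D   *)
Definition is_pullback (P A B D : C)
    (p : hom P A) (q : hom P B) (f : hom A D) (g : hom B D) : Prop :=
  f ∘ p = g ∘ q /\
  forall (X : C) (h : hom X A) (k : hom X B), f ∘ h = g ∘ k ->
    exists! l : hom X P, p ∘ l = h /\ q ∘ l = k.

Definition lifts (A B X Y : C) (m : hom A B) (f : hom X Y) : Prop :=
  forall (h : hom A X) (k : hom B Y), f ∘ h = k ∘ m ->
    exists l : hom B X, l ∘ m = h /\ f ∘ l = k.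

End CategoryNotions.

(* In a path category binary products exist, as pullbacks of B -> 1 along
   A -> 1.  A choice of them is carried along so that "A × B" and "⟨f, g⟩" are
   functions; every notion below is invariant under changing that choice. *)
Record cartesian_category := CartesianCategory {
  cat_of :> category;
  one : cat_of;
  bang : forall A : cat_of, hom A one;
  bang_unique : forall (A : cat_of) (f : hom A one), f = bang A;
  prd : cat_of -> cat_of -> cat_of;
  pi0 : forall A B : cat_of, hom (prd A B) A;
  pi1 : forall A B : cat_of, hom (prd A B) B;
  pairing : forall X A B : cat_of, hom X A -> hom X B -> hom X (prd A B);
  pi0_pairing : forall (X A B : cat_of) (f : hom X A) (g : hom X B),
    pi0 A B ∘ pairing f g = f;
  pi1_pairing : forall (X A B : cat_of) (f : hom X A) (g : hom X B),
    pi1 A B ∘ pairing f g = g;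
  pairing_unique : forall (X A B : cat_of) (h : hom X (prd A B)),
    h = pairing (pi0 A B ∘ h) (pi1 A B ∘ h)
}.

Arguments bang {c} A.
Arguments prd {c} A B.
Arguments pi0 {c} {A B}.
Arguments pi1 {c} {A B}.
Arguments pairing {c X A B} f g.

Notation "A × B" := (prd A B) (at level 40, left associativity)
  : pathcat_scope.
Notation "⟨ f , g ⟩" := (pairing f g) (format "⟨ f ,  g ⟩") : pathcat_scope.

Definition diag (C : cartesian_category) (B : C) : hom B (B × B) :=
  ⟨ idm B, idm B ⟩.

Definition prd_map (C : cartesian_category) (A A' B B' : C)
    (f : hom A A') (g : hom B B') : hom (A × B) (A' × B') :=
  ⟨ f ∘ pi0, g ∘ pi1 ⟩.

Record path_category := PathCategory {
  cart_of :> cartesian_category;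
  fib : forall A B : cart_of, hom A B -> Prop;
  weq : forall A B : cart_of, hom A B -> Prop;
  fib_comp : forall (A B D : cart_of) (g : hom B D) (f : hom A B),
    fib g -> fib f -> fib (g ∘ f);
  fib_pullback_exists :
    forall (A B D : cart_of) (f : hom A D) (g : hom B D), fib f ->
    exists (P : cart_of) (p : hom P A) (q : hom P B), is_pullback p q f g;
  fib_pullback :
    forall (P A B D : cart_of)
      (p : hom P A) (q : hom P B) (f : hom A D) (g : hom B D),
    is_pullback p q f g -> fib f -> fib q;
  trivfib_pullback :
    forall (P A B D : cart_of)
      (p : hom P A) (q : hom P B) (f : hom A D) (g : hom B D),
    is_pullback p q f g -> fib f /\ weq f -> fib q /\ weq q;
  weq_2of6 :
    forall (A B D E : cart_of) (f : hom A B) (g : hom B D) (h : hom D E),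
    weq (g ∘ f) -> weq (h ∘ g) ->
    weq f /\ weq g /\ weq h /\ weq (h ∘ g ∘ f);
  iso_trivfib : forall (A B : cart_of) (f : hom A B),
    is_iso f -> fib f /\ weq f;
  trivfib_section : forall (A B : cart_of) (f : hom A B),
    fib f /\ weq f -> exists s : hom B A, f ∘ s = idm B;
  fib_bang : forall B : cart_of, fib (bang B);
  path_object_exists : forall B : cart_of,
    exists (PB : cart_of) (r : hom B PB) (p : hom PB (B × B)),
      weq r /\ fib p /\ p ∘ r = diag B
}.

Section PathCategoryNotions.
Variable C : path_category.

Definition trivfib (A B : C) (f : hom A B) : Prop := fib f /\ weq f.

Definition cofibration (A B : C) (m : hom A B) : Prop :=
  forall (X Y : C) (f : hom X Y), trivfib f -> lifts m f.

Definition is_path_object (B PB : C)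
    (r : hom B PB) (p : hom PB (B × B)) : Prop :=
  weq r /\ fib p /\ p ∘ r = diag B.

Definition is_homotopy (Y PY : C) (p : hom PY (Y × Y))
    (X : C) (f g : hom X Y) (H : hom X PY) : Prop :=
  (pi0 ∘ p) ∘ H = f /\ (pi1 ∘ p) ∘ H = g.

Definition homotopic (X Y : C) (f g : hom X Y) : Prop :=
  exists (PY : C) (r : hom Y PY) (p : hom PY (Y × Y)) (H : hom X PY),
    is_path_object r p /\ is_homotopy p f g H.

Definition small (V U : C) (u : hom V U) (A B : C) (f : hom A B) : Prop :=
  exists (i : hom A V) (k : hom B U), is_pullback i f u k.

(* q is a fibration over u × u, compatible with r and p, such that the induced
   map PV -> PU ×_(U × U) (V × V) is a fibration; the pullback L exists since
   pU is a fibration. *)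
Definition path_objects_over (V U : C) (u : hom V U)
    (PU : C) (rU : hom U PU) (pU : hom PU (U × U))
    (PV : C) (rV : hom V PV) (pV : hom PV (V × V)) (q : hom PV PU) : Prop :=
  is_path_object rU pU /\ is_path_object rV pV /\
  fib q /\ q ∘ rV = rU ∘ u /\ pU ∘ q = prd_map u u ∘ pV /\
  forall (L : C) (l1 : hom L PU) (l2 : hom L (V × V)),
    is_pullback l1 l2 pU (prd_map u u) ->
    forall k : hom PV L, l1 ∘ k = q -> l2 ∘ k = pV -> fib k.

Definition univalent_fibration (V U : C) (u : hom V U) : Prop :=
  fib u /\
  exists (PU : C) (rU : hom U PU) (pU : hom PU (U × U))
         (PV : C) (rV : hom V PV) (pV : hom PV (V × V)) (q : hom PV PU),
    path_objects_over u rU pU rV pV q /\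
    forall (A B D : C) (a : hom A D) (b : hom B D)
      (i : hom A V) (j : hom B V) (f g : hom D U),
      is_pullback i a u f -> is_pullback j b u g ->
      forall e : hom A B, weq e -> b ∘ e = a ->
      exists (H : hom D PU) (K : hom A PV),
        is_homotopy pU g f H /\ is_homotopy pV (j ∘ e) i K /\ q ∘ K = H ∘ a.

Definition univalent_path_category : Prop :=
  forall (A B : C) (f : hom A B), fib f ->
    exists (V U : C) (u : hom V U), univalent_fibration u /\ small u f.

(* A × A × A is (A × A) × A, with projections pi0 ∘ pi0, pi1 ∘ pi0 and pi1. *)
Definition homogeneous (A : C) : Prop :=
  exists e : hom (A × A × A) (A × A × A),
    let p01 : hom (A × A × A) (A × A) := ⟨ pi0 ∘ pi0, pi1 ∘ pi0 ⟩ in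
    let p2 : hom (A × A × A) A := pi1 in
    let s0 : hom (A × A) (A × A × A) := ⟨ ⟨ pi0, pi1 ⟩, pi0 ⟩ in
    let s1 : hom (A × A) (A × A × A) := ⟨ ⟨ pi0, pi1 ⟩, pi1 ⟩ in
    weq e /\ p01 ∘ e = p01 /\ homotopic (p2 ∘ e ∘ s0) (p2 ∘ s1).

End PathCategoryNotions.

Arguments univalent_path_category : clear implicits.

(* Main.v *)
Require Import Defs.
Local Open Scope pathcat_scope.

(** The argument is Kraus' paradox, read in a path category.

    Let [u : V -> U] be a univalent fibration for which [A -> 1] is small, so
    that [A] is the fibre of [u] over a point [k : 1 -> U].  The inclusion
    [i : A -> V] is a pullback of a map out of [1], hence a monomorphism; one
    may think of [i a] as the pointed type [(A, a)].  Univalence, applied to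
    the self-equivalence of [A × A × A] over [A × A] that witnesses
    homogeneity, says that all these pointed types are equal: the maps [i ∘ π0]
    and [i ∘ π1] from [A × A] to [V] are homotopic.

    A map homotopic to one that extends along a cofibration extends too
    ([homotopy_extension]), because the endpoint maps of a path object are
    trivial fibrations.  Now [i ∘ π0] extends along the cofibration [A × m] to
    [i ∘ π0 : A × B -> V].  Hence so does [i ∘ π1]: there is
    [N : A × B -> V] with [N (x, m y) = i y] strictly.  If [m ∘ f = m ∘ g] then
    [i ∘ f = N ∘ ⟨f, m ∘ f⟩ = N ∘ ⟨f, m ∘ g⟩ = i ∘ g], and so [f = g].

    Homogeneity provides a homotopy in [A], which has to be transported along
    [i] to a homotopy in [V].  This is [path_object_map], which rests on the
    factorisation of every map as a weak equivalence followed by a fibration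
    ([factorisation]). *)

(** * Products and fibres *)

Section Products.
Context {C : cartesian_category}.

Lemma pairing_ext {X A B : C} (h k : hom X (A × B)) :
  pi0 ∘ h = pi0 ∘ k -> pi1 ∘ h = pi1 ∘ k -> h = k.
Proof.
  intros H0 H1. rewrite (pairing_unique h), (pairing_unique k), H0, H1.
  reflexivity.
Qed.

Lemma pairing_comp {X Y A B : C} (f : hom X A) (g : hom X B) (h : hom Y X) :
  ⟨f, g⟩ ∘ h = ⟨f ∘ h, g ∘ h⟩.
Proof.
  apply pairing_ext; rewrite comp_assoc.
  - now rewrite !pi0_pairing.
  - now rewrite !pi1_pairing.
Qed.

Lemma prd_map_pairing {X A A' B B' : C} (f : hom A A') (g : hom B B')
    (h : hom X A) (k : hom X B) :
  prd_map f g ∘ ⟨h, k⟩ = ⟨f ∘ h, g ∘ k⟩.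
Proof.
  unfold prd_map. rewrite pairing_comp, <- !comp_assoc.
  now rewrite pi0_pairing, pi1_pairing.
Qed.

Lemma to_one_unique {X : C} (f g : hom X (one C)) : f = g.
Proof. now rewrite (bang_unique f), (bang_unique g). Qed.

Lemma pi0_pullback (A B : C) :
  is_pullback (pi1 : hom (A × B) B) (pi0 : hom (A × B) A) (bang B) (bang A).
Proof.
  split; [apply to_one_unique|].
  intros X h k _. exists ⟨k, h⟩. split.
  - now rewrite pi0_pairing, pi1_pairing.
  - intros l [<- <-]. symmetry. apply pairing_unique.
Qed.

Lemma pi1_pullback (A B : C) :
  is_pullback (pi0 : hom (A × B) A) (pi1 : hom (A × B) B) (bang A) (bang B).
Proof.
  split; [apply to_one_unique|].
  intros X h k _. exists ⟨h, k⟩. split.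
  - now rewrite pi0_pairing, pi1_pairing.
  - intros l [<- <-]. symmetry. apply pairing_unique.
Qed.

(** The inclusion of the fibre of [u] over a global point is a monomorphism. *)
Lemma fibre_mono {A V U : C} (i : hom A V) (u : hom V U) (k : hom (one C) U) :
  is_pullback i (bang A) u k -> mono i.
Proof.
  intros [Hsq Huni] X f g Hfg.
  destruct (Huni X (i ∘ g) (bang X)) as [l [_ Hl]].
  { rewrite comp_assoc, Hsq, <- comp_assoc. f_equal. apply to_one_unique. }
  transitivity l; [symmetry|]; apply Hl; split; auto using to_one_unique.
Qed.

(** If [A] is the fibre of [u] over [k], then the projection [D × A -> D] is
    the pullback of [u] along the constant map [D -> U] at [k]. *)
Lemma fibre_pullback {A V U : C} (i : hom A V) (u : hom V U)
    (k : hom (one C) U) (D : C) :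
  is_pullback i (bang A) u k ->
  is_pullback (i ∘ pi1) (pi0 : hom (D × A) D) u (k ∘ bang D).
Proof.
  intros Hpb. pose proof (fibre_mono i u k Hpb) as Hmono.
  destruct Hpb as [Hsq Huni]. split.
  - rewrite comp_assoc, Hsq, <- !comp_assoc. f_equal. apply to_one_unique.
  - intros X h l Hhl.
    destruct (Huni X h (bang X)) as [z [[Hz _] _]].
    { rewrite Hhl, <- comp_assoc. f_equal. apply to_one_unique. }
    exists ⟨l, z⟩. split.
    + split; [now rewrite <- comp_assoc, pi1_pairing|apply pi0_pairing].
    + intros l' [H1 H0]. apply pairing_ext.
      * now rewrite pi0_pairing.
      * rewrite pi1_pairing. apply Hmono. now rewrite Hz, comp_assoc.
Qed.

End Products.

(** * Paths and homotopies *)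

Section PathCategories.
Context {C : path_category}.

Lemma weq_id (A : C) : weq (idm A).
Proof.
  apply iso_trivfib. exists (idm A). split; apply comp_idl.
Qed.

Lemma weq_cancel_r {A B D : C} (g : hom B D) (f : hom A B) :
  weq f -> weq (g ∘ f) -> weq g.
Proof.
  intros Hf Hgf.
  destruct (weq_2of6 (f := idm A) (g := f) (h := g)) as [_ [_ [H _]]]; auto.
  now rewrite comp_idr.
Qed.

Lemma weq_cancel_l {A B D : C} (g : hom B D) (f : hom A B) :
  weq g -> weq (g ∘ f) -> weq f.
Proof.
  intros Hg Hgf.
  destruct (weq_2of6 (f := f) (g := g) (h := idm D)) as [H _]; auto.
  now rewrite comp_idl.
Qed.

Lemma fib_pi0 (A B : C) : fib (pi0 : hom (A × B) A).
Proof. exact (fib_pullback (pi0_pullback A B) (fib_bang B)). Qed.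

Lemma fib_pi1 (A B : C) : fib (pi1 : hom (A × B) B).
Proof. exact (fib_pullback (pi1_pullback A B) (fib_bang A)). Qed.

Lemma path_start_trivfib {B PB : C} (r : hom B PB) (p : hom PB (B × B)) :
  is_path_object r p -> trivfib (pi0 ∘ p).
Proof.
  intros [Hr [Hp Hpr]]. split.
  - apply fib_comp; [apply fib_pi0|exact Hp].
  - apply (weq_cancel_r _ r Hr). rewrite <- comp_assoc, Hpr.
    unfold diag. rewrite pi0_pairing. apply weq_id.
Qed.

Lemma path_end_trivfib {B PB : C} (r : hom B PB) (p : hom PB (B × B)) :
  is_path_object r p -> trivfib (pi1 ∘ p).
Proof.
  intros [Hr [Hp Hpr]]. split.
  - apply fib_comp; [apply fib_pi1|exact Hp].
  - apply (weq_cancel_r _ r Hr). rewrite <- comp_assoc, Hpr.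
    unfold diag. rewrite pi1_pairing. apply weq_id.
Qed.

(** The mapping path object of [f : X -> E], whose points are a point [x] of
    [X] and a path in [E] starting at [f x], factors [f]. *)
Lemma factorisation {X E : C} (f : hom X E) :
  exists (F : C) (w : hom X F) (g : hom F E), weq w /\ fib g /\ g ∘ w = f.
Proof.
  destruct (path_object_exists E) as [PE [r [p HP]]].
  pose proof (path_start_trivfib r p HP) as Hp0.
  destruct HP as [Hr [Hp Hpr]].
  destruct (fib_pullback_exists (prd_map f (idm E)) Hp) as [F [c [d HF]]].
  pose proof (fib_pullback HF Hp) as Hd.
  destruct HF as [Hsq Huni].
  (* [F] is also the pullback of the trivial fibration [pi0 ∘ p] along [f]. *)
  assert (HF0 : is_pullback c (pi0 ∘ d) (pi0 ∘ p) f).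
  { split.
    - rewrite <- comp_assoc, Hsq. unfold prd_map.
      now rewrite !comp_assoc, pi0_pairing.
    - intros Z h k Hhk.
      destruct (Huni Z h ⟨k, pi1 ∘ p ∘ h⟩) as [l [[Hl1 Hl2] Hl]].
      { rewrite prd_map_pairing, comp_idl, <- Hhk, <- !comp_assoc.
        apply pairing_unique. }
      exists l. split.
      + split; [exact Hl1|]. now rewrite <- comp_assoc, Hl2, pi0_pairing.
      + intros l' [H1 H2]. apply Hl. split; [exact H1|].
        apply pairing_ext.
        * now rewrite pi0_pairing, comp_assoc.
        * rewrite pi1_pairing, <- H1.
          rewrite <- (comp_assoc pi1 p (c ∘ l')), (comp_assoc p c l'), Hsq.
          unfold prd_map.
          now rewrite !comp_assoc, pi1_pairing, comp_idl. }
  destruct (trivfib_pullback HF0 Hp0) as [_ Hd0].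
  destruct (Huni X (r ∘ f) ⟨idm X, f⟩) as [w [[Hw1 Hw2] _]].
  { rewrite comp_assoc, Hpr, prd_map_pairing, comp_idl, comp_idr.
    unfold diag. now rewrite pairing_comp, comp_idl. }
  exists F, w, (pi1 ∘ d). split; [|split].
  - apply (weq_cancel_l (pi0 ∘ d) w Hd0).
    rewrite <- comp_assoc, Hw2, pi0_pairing. apply weq_id.
  - apply fib_comp; [apply fib_pi1|exact Hd].
  - now rewrite <- comp_assoc, Hw2, pi1_pairing.
Qed.

(** A fibration through which a weak equivalence into its base lifts has a
    section; this is the path category form of path induction. *)
Lemma section_of_weq_lift {X Y E : C} (p : hom E Y) (w : hom X Y)
    (s : hom X E) :
  fib p -> weq w -> p ∘ s = w -> exists t : hom Y E, p ∘ t = idm Y.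
Proof.
  intros Hp Hw Hs.
  destruct (factorisation s) as [F [v [g [Hv [Hg Hgv]]]]].
  destruct (@trivfib_section C F Y (p ∘ g)) as [t Ht].
  { split; [now apply fib_comp|].
    apply (weq_cancel_r _ v Hv). now rewrite <- comp_assoc, Hgv, Hs. }
  exists (g ∘ t). now rewrite comp_assoc.
Qed.

(** Every map acts on paths, strictly compatibly with endpoints. *)
Lemma path_object_map {A V PA PV : C} (i : hom A V)
    (rA : hom A PA) (pA : hom PA (A × A))
    (rV : hom V PV) (pV : hom PV (V × V)) :
  is_path_object rA pA -> is_path_object rV pV ->
  exists j : hom PA PV, pV ∘ j = prd_map i i ∘ pA.
Proof.
  intros [HrA [HpA HA]] [HrV [HpV HV]].
  destruct (fib_pullback_exists (prd_map i i ∘ pA) HpV) as [E [x [y HE]]].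
  pose proof (fib_pullback HE HpV) as Hy.
  destruct HE as [Hsq Huni].
  destruct (Huni A (rV ∘ i) rA) as [s [[_ Hs] _]].
  { rewrite comp_assoc, HV, <- comp_assoc, HA. unfold diag.
    now rewrite prd_map_pairing, pairing_comp, comp_idl, comp_idr. }
  destruct (section_of_weq_lift y rA s Hy HrA Hs) as [t Ht].
  exists (x ∘ t). now rewrite comp_assoc, Hsq, <- comp_assoc, Ht, comp_idr.
Qed.

(** The homotopies here take values in a given path object, as univalence of a
    fibration provides one of its own choice. *)
Lemma homotopic_postcomp {X A V PV : C} (i : hom A V) (f g : hom X A)
    (rV : hom V PV) (pV : hom PV (V × V)) :
  is_path_object rV pV -> homotopic f g ->
  exists H : hom X PV, is_homotopy pV (i ∘ f) (i ∘ g) H.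
Proof.
  intros HV [PA [rA [pA [H [HA [Hf Hg]]]]]].
  destruct (path_object_map i rA pA rV pV HA HV) as [j Hj].
  exists (j ∘ H). split.
  - rewrite <- comp_assoc, (comp_assoc pV), Hj, <- Hf. unfold prd_map.
    now rewrite !comp_assoc, pi0_pairing.
  - rewrite <- comp_assoc, (comp_assoc pV), Hj, <- Hg. unfold prd_map.
    now rewrite !comp_assoc, pi1_pairing.
Qed.

Lemma homotopy_extension {X Y V PV : C} (n : hom X Y)
    (r : hom V PV) (p : hom PV (V × V)) (f g : hom X V) (H : hom X PV)
    (F : hom Y V) :
  cofibration n -> is_path_object r p -> is_homotopy p f g H -> F ∘ n = f ->
  exists G : hom Y V, G ∘ n = g.
Proof.
  intros Hn HP [Hf Hg] HF.
  destruct (Hn _ _ _ (path_start_trivfib r p HP) H F) as [L [HL _]].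
  { now rewrite HF. }
  exists (pi1 ∘ p ∘ L). now rewrite <- comp_assoc, HL.
Qed.

Lemma homotopy_extension_rev {X Y V PV : C} (n : hom X Y)
    (r : hom V PV) (p : hom PV (V × V)) (f g : hom X V) (H : hom X PV)
    (G : hom Y V) :
  cofibration n -> is_path_object r p -> is_homotopy p f g H -> G ∘ n = g ->
  exists F : hom Y V, F ∘ n = f.
Proof.
  intros Hn HP [Hf Hg] HG.
  destruct (Hn _ _ _ (path_end_trivfib r p HP) H G) as [L [HL _]].
  { now rewrite HG. }
  exists (pi0 ∘ p ∘ L). now rewrite <- comp_assoc, HL.
Qed.

End PathCategories.

(** * Cofibrations with homogeneous domain *)

Theorem corollary5p8 (C : path_category)
  (Huniv : univalent_path_category C)
  (Hprod : forall (A B : C) (m : hom A B), cofibration m ->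
    forall D : C, cofibration (prd_map (idm D) m))
  (A B : C) (m : hom A B) :
  cofibration m -> homogeneous A -> mono m.
Proof.
  intros Hm [e [He [Hp01 Hhom]]].
  destruct (Huniv A (one C) (bang A) (fib_bang A))
    as [V [U [u [[_ [PU [rU [pU [PV [rV [pV [q [Hover Hua]]]]]]]]] [i [k Hpb]]]]]].
  destruct Hover as [_ [HPV _]].
  pose proof (fibre_mono i u k Hpb) as Hi.
  pose proof (fibre_pullback i u k (A × A) Hpb) as Hpb2.
  rewrite <- (pairing_unique pi0) in Hp01.
  destruct (Hua _ _ _ _ _ _ _ _ _ Hpb2 Hpb2 e He Hp01)
    as [_ [K [_ [[HK0 HK1] _]]]].
  rewrite pi1_pairing in Hhom.
  set (s0 := ⟨⟨pi0, pi1⟩, pi0⟩ : hom (A × A) (A × A × A)) in *.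
  destruct (homotopic_postcomp i _ _ rV pV HPV Hhom) as [H HH].
  (* In terms of points, [K ∘ s0] is a path from [i (π2 (e (x, y, x)))] to
     [i x], and [H] one from [i (π2 (e (x, y, x)))] to [i y]. *)
  assert (HKs : is_homotopy pV (i ∘ (pi1 ∘ e ∘ s0)) (i ∘ pi0) (K ∘ s0)).
  { split.
    - now rewrite comp_assoc, HK0, !comp_assoc.
    - rewrite comp_assoc, HK1, <- comp_assoc. unfold s0.
      now rewrite pi1_pairing. }
  pose proof (Hprod A B m Hm A) as HAm.
  destruct (homotopy_extension_rev _ rV pV _ _ _ (i ∘ pi0) HAm HPV HKs)
    as [N' HN'].
  { unfold prd_map. now rewrite <- comp_assoc, pi0_pairing, comp_idl. }
  destruct (homotopy_extension _ rV pV _ _ _ N' HAm HPV HH HN') as [N HN].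
  assert (HNp : forall (X : C) (x y : hom X A), N ∘ ⟨x, m ∘ y⟩ = i ∘ y).
  { intros X x y.
    pose proof (prd_map_pairing (idm A) m x y) as Hxy.
    rewrite comp_idl in Hxy.
    now rewrite <- Hxy, comp_assoc, HN, <- comp_assoc, pi1_pairing. }
  intros X f g Hfg. apply Hi.
  now rewrite <- (HNp X f f), Hfg, HNp.
Qed.
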